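(* Let $p$ be a large prime, let $k$ be a positive integer, let $N$ be an integer with $2\le N<p$, and let $I=[1,N]$. Then the number $J_{2k}$ of solutions of the congruence $$x_1^*+\dots+x_k^*\equiv x_{k+1}^*+\dots+x_{2k}^*\pmod p,\qquad x_1,\dots,x_{2k}\in I,$$ satisfies $$J_{2k}<(2k)^{90k^3}(\log N)^{4k^2}\left(\frac{N^{2k-1}}{p}+1\right)N^{k}.$$
   Context: $[1,N]$ denotes the set of integers $1,\dots,N$. For an integer $x$ coprime to $p$, $x^*$ denotes its multiplicative inverse modulo $p$. ''Large prime'' means $p\ge p_0$ for some absolute constant $p_0$ (independent of $k$ and $N$). *)

(* Defs.v *)
From mathcomp Require Import all_boot all_order all_algebra.
From mathcomp Require Import all_classical all_reals all_analysis.

Set Implicit Arguments.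
Unset Strict Implicit.
Unset Printing Implicit Defensive.

Import Order.TTheory GRing.Theory Num.Theory.

Local Open Scope ring_scope.

(* The 2k unknowns are indexed by 'I_(k + k): [lshift k i] runs over the first
   k of them and [rshift k i] over the last k.  For p prime and N < p, every
   x in [1, N] is nonzero in the field 'F_p, so the field inverse is x^*, and
   equality in 'F_p is congruence modulo p. *)
Definition J (p k N : nat) : nat :=
  #|[set x : {ffun 'I_(k + k) -> 'I_N.+1} |
      [forall i, (1 <= x i <= N)%N] &&
      (\sum_(i < k) ((x (lshift k i))%:R : 'F_p)^-1 ==
       \sum_(i < k) ((x (rshift k i))%:R : 'F_p)^-1)]%SET|.

(* Main.v *)
Require Import Defs.
From mathcomp Require Import all_boot all_order all_algebra.
From mathcomp Require Import all_classical all_reals all_analysis.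
From mathcomp Require Import zify ring lra.

Set Implicit Arguments.
Unset Strict Implicit.
Unset Printing Implicit Defensive.

Import Order.TTheory GRing.Theory Num.Theory.

Local Open Scope ring_scope.

(* A k-tuple x has a reduced fraction a / b = 1/x_1 + ... + 1/x_k, and two
   tuples solve the congruence iff a b' - a' b = lambda p for an integer lambda
   with |lambda| p <= k N^(2k-1).  Cauchy-Schwarz, applied to the dyadic levels
   of b, reduces to the case where b and b' lie in the same interval
   [2^t, 2^(t+1)); then, for fixed lambda, each of the two fractions determines
   the other, so there are at most as many solutions as pairs of tuples with
   equal reciprocal sums in Q.

   If a signed sum of n = 2k reciprocals vanishes, then for every prime q the
   largest q-adic valuation of the z_i is attained twice.  Weighting each tuple
   by (prod_i N / z_i)^(1/2) >= 1 bounds their number by N^k times a product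
   over primes q <= N of local factors 1 + binomial(n, 2) / q + O(n^3 q^(-3/2)).
   Primes q <= n^4 are treated trivially, and Chebyshev's bound
   sum_{q <= N} 1/q <= 2 log log N + O(1) yields the power of log N. *)

(** * Reduced fractions of reciprocal sums *)

Definition recip_num (I : finType) (x : I -> nat) : nat :=
  (\sum_i \prod_(j | j != i) x j)%N.

Definition recip_den (I : finType) (x : I -> nat) : nat := (\prod_i x i)%N.

Definition redfrac (A B : nat) : nat * nat :=
  (A %/ gcdn A B, B %/ gcdn A B)%N.

Definition recip_frac (I : finType) (x : I -> nat) : nat * nat :=
  redfrac (recip_num x) (recip_den x).

Lemma redfracP (A B : nat) : (0 < B)%N ->
  [/\ coprime (redfrac A B).1 (redfrac A B).2,
      (redfrac A B).1 * gcdn A B = A & (redfrac A B).2 * gcdn A B = B]%N.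
Proof.
move=> B_gt0; have g_gt0 : (0 < gcdn A B)%N by rewrite gcdn_gt0 B_gt0 orbT.
have eA := divnK (dvdn_gcdl A B); have eB := divnK (dvdn_gcdr A B).
split=> //=; rewrite /coprime -(eqn_pmul2r g_gt0) muln_gcdl eA eB mul1n //.
Qed.

Section RecipFrac.
Variables (I : finType) (x : I -> nat).
Hypothesis x_gt0 : forall i, (0 < x i)%N.

Lemma recip_den_gt0 : (0 < recip_den x)%N.
Proof. exact: prodn_gt0. Qed.

Lemma recip_frac_coprime : coprime (recip_frac x).1 (recip_frac x).2.
Proof. by case: (redfracP (recip_num x) recip_den_gt0). Qed.

Lemma recip_frac_den_dvd : ((recip_frac x).2 %| recip_den x)%N.
Proof.
have [_ _ eB] := redfracP (recip_num x) recip_den_gt0.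
by apply/dvdnP; exists (gcdn (recip_num x) (recip_den x)); rewrite mulnC eB.
Qed.

Lemma recip_frac_den_gt0 : (0 < (recip_frac x).2)%N.
Proof. exact: dvdn_gt0 recip_den_gt0 recip_frac_den_dvd. Qed.

Lemma recip_frac_num_le : ((recip_frac x).1 <= recip_num x)%N.
Proof. exact: leq_div. Qed.

Lemma recip_frac_den_le (N : nat) : (forall i, (x i <= N)%N) ->
  ((recip_frac x).2 <= N ^ #|I|)%N.
Proof.
move=> xN; apply: leq_trans (dvdn_leq recip_den_gt0 recip_frac_den_dvd) _.
by rewrite -prod_nat_const; apply: leq_prod.
Qed.

Lemma recip_frac_num_bound (N : nat) : (forall i, (x i <= N)%N) ->
  ((recip_frac x).1 <= #|I| * N ^ #|I|.-1)%N.
Proof.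
move=> xN; apply: leq_trans recip_frac_num_le _.
rewrite -sum_nat_const; apply: leq_sum => i _.
have -> : #|I|.-1 = #|[pred j | j != i]|.
  have := cardC (pred1 i); rewrite card1 => <- /=.
  by apply: eq_card => j; rewrite !inE.
by rewrite -prod_nat_const; apply: leq_prod.
Qed.

(** Stated over any field where the entries are invertible, so that one fraction serves both in
    ['F_p], for the congruence, and in [rat], for the vanishing signed sum. *)
Lemma sum_recip (F : fieldType) : (forall i, (x i)%:R != 0 :> F) ->
  \sum_i ((x i)%:R : F)^-1 = (recip_frac x).1%:R / (recip_frac x).2%:R.
Proof.
move=> x_neq0.
have B_neq0 : (recip_den x)%:R != 0 :> F.
  by rewrite natr_prod; apply/prodf_neq0.
have [_ /(congr1 (fun m => m%:R : F)) eA /(congr1 (fun m => m%:R : F)) eB] :=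
  redfracP (recip_num x) recip_den_gt0.
rewrite /= natrM in eA; rewrite /= natrM in eB.
have g_neq0 : (gcdn (recip_num x) (recip_den x))%:R != 0 :> F.
  by apply: contraNneq B_neq0 => g0; rewrite -eB g0 mulr0.
transitivity ((recip_num x)%:R / (recip_den x)%:R : F); last first.
  by rewrite -eA -eB invfM mulrACA divff // mulr1.
apply: (mulIf B_neq0); rewrite mulfVK // mulr_suml natr_sum.
apply: eq_bigr => i _.
by rewrite /recip_den (bigD1 i) //= natrM mulKf.
Qed.

End RecipFrac.

(** * Counting pairs with equal images: Cauchy-Schwarz and matchings *)

Lemma sqr_sum_le (D : nat) (u : 'I_D -> nat) :
  ((\sum_t u t) ^ 2 <= D * \sum_t u t ^ 2)%N.
Proof.
rewrite -(leq_pmul2l (isT : (0 < 2)%N)).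
have -> : ((\sum_t u t) ^ 2 = \sum_s \sum_t u s * u t)%N.
  by rewrite -mulnn big_distrl /=; apply: eq_bigr => s _; rewrite big_distrr.
have -> : (2 * (D * \sum_t u t ^ 2) = \sum_s \sum_t (u s ^ 2 + u t ^ 2))%N.
  rewrite [RHS](eq_bigr (fun s => D * u s ^ 2 + \sum_t u t ^ 2)%N) => [|s _]; last first.
    by rewrite big_split /= sum_nat_const card_ord.
  by rewrite big_split /= sum_nat_const card_ord -big_distrr /=; lia.
rewrite big_distrr; apply: leq_sum => s _; rewrite big_distrr.
by apply: leq_sum => t _; apply: nat_Cauchy.
Qed.


Definition pairs_eq (T : finType) (C : eqType) (A : pred T) (f : T -> C) :=
  [pred z : T * T | [&& A z.1, A z.2 & f z.1 == f z.2]].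

Lemma two_le_ratio_sum (u v : rat) : 0 < u -> 0 < v -> 2%:R <= u / v + v / u.
Proof.
move=> u0 v0; rewrite -subr_ge0.
have -> : u / v + v / u - 2%:R = (u - v) ^+ 2 / (u * v).
  by field; rewrite !gt_eqF.
by rewrite divr_ge0 ?sqr_ge0 // mulr_ge0 // ltW.
Qed.

Section PairCounts.
Variables (T : finType) (A : pred T).

Lemma card_pred_pair (P : rel T) :
  #|[pred z : T * T | P z.1 z.2]| = (\sum_x #|[pred y | P x y]|)%N.
Proof.
rewrite -sum1_card -(pair_big_dep xpredT (fun x y => P x y) (fun _ _ => 1%N)) /=.
by apply: eq_bigr => x _; rewrite sum1_card.
Qed.

Lemma card_pairs_eq (C : finType) (f : T -> C) :
  #|pairs_eq A f| = (\sum_c #|[pred x | A x & f x == c]| ^ 2)%N.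
Proof.
rewrite (card_pred_pair (fun x y => [&& A x, A y & f x == f y])).
rewrite (partition_big f xpredT) //=; apply: eq_bigr => c _.
rewrite -mulnn -sum_nat_const [RHS]big_mkcond [LHS]big_mkcond /=.
apply: eq_bigr => x _; rewrite inE; case: (eqVneq (f x) c) => [<-|_]; last first.
  by rewrite andbF.
case Ax: (A x) => /=; last by apply: eq_card0 => y; rewrite !inE.
by apply: eq_card => y; rewrite !inE eq_sym.
Qed.

(** Each fibre of [f] is cut by [t] into at most [D] pieces; Cauchy-Schwarz on their sizes costs the
    factor [D]. *)
Lemma card_pairs_eq_split (C : finType) (D : nat) (f : T -> C) (t : T -> 'I_D) :
  (#|pairs_eq A f| <= D * #|pairs_eq A (fun x => (f x, t x))|)%N.
Proof.
rewrite !card_pairs_eq.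
rewrite -(pair_bigA _ (fun c s => #|[pred x | A x & (f x, t x) == (c, s)]| ^ 2)%N).
rewrite big_distrr; apply: leq_sum => c _.
have -> : (#|[pred x | A x & f x == c]| =
    \sum_s #|[pred x | A x & (f x, t x) == (c, s)]|)%N.
  rewrite -sum1_card (partition_big t xpredT) //=; apply: eq_bigr => s _.
  by rewrite -sum1_card; apply: eq_bigl => x; rewrite !inE xpair_eqE andbA.
exact: sqr_sum_le.
Qed.

Lemma swap_pairK : involutive (fun z : T * T => (z.2, z.1)).
Proof. by case. Qed.

Section MatchedPairs.
Variables (K : eqType) (key : T -> K).

Let cls x := #|[pred y | A y & key x == key y]|.

(** For fixed [x] all partners [y] lie in one key class, so there are at most [cls y] of them, each
    with weight [1 / cls y]. What remains is at most [cls x], and summing over [x] counts the pairs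
    with equal keys. *)
Lemma sum_cls_ratio (rho : rel T) :
    (forall x y, rho x y -> A x && A y) ->
    (forall x y y', rho x y -> rho x y' -> key y == key y') ->
  \sum_(z | rho z.1 z.2) (cls z.1)%:R / (cls z.2)%:R <= #|pairs_eq A key|%:R :> rat.
Proof.
move=> rhoA rho_key.
rewrite -(pair_big_dep xpredT (fun x y => rho x y)
  (fun x y => (cls x)%:R / (cls y)%:R : rat)) /=.
rewrite (card_pred_pair (fun x y => [&& A x, A y & key x == key y])) natr_sum.
apply: ler_sum => x _; rewrite -mulr_sumr.
have [y0 rxy0|no_y] := pickP (rho x); last first.
  by rewrite big_pred0 // mulr0 ler0n.
have /andP[Ax Ay0] := rhoA _ _ rxy0.
rewrite (eq_card (B := [pred y | A y & key x == key y])); last first.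
  by move=> y; rewrite !inE Ax.
rewrite -[leRHS]mulr1 ler_wpM2l ?ler0n //.
rewrite (eq_bigr (fun=> (cls y0)%:R^-1)) => [|y rxy]; last first.
  by rewrite /cls (eqP (rho_key _ _ _ rxy rxy0)).
have cls_gt0 : (0 < cls y0)%N.
  by apply/card_gt0P; exists y0; rewrite inE Ay0 eqxx.
rewrite sumr_const -[_ *+ _]mulr_natl ler_pdivrMr ?ltr0n // mul1r ler_nat.
apply/subset_leq_card/fintype.subsetP => y rxy; rewrite inE.
by have /andP[_ ->] := rhoA _ _ rxy; rewrite (rho_key _ _ _ rxy0 rxy).
Qed.

(* A matching between key classes contributes [sum r s] over matched class
   sizes, at most [sum (r^2 + s^2) / 2]. *)
Lemma card_matched_pairs (rho : rel T) :
    (forall x y, rho x y -> A x && A y) ->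
    (forall x x' y y', rho x y -> rho x' y' ->
       (key x == key x') = (key y == key y')) ->
  (#|[pred z | rho z.1 z.2]| <= #|pairs_eq A key|)%N.
Proof.
move=> rhoA rho_key; rewrite -(ler_nat rat) -(@ler_pM2l _ 2%:R) //.
have cls_neq0 x : A x -> (cls x)%:R != 0 :> rat.
  move=> Ax; rewrite pnatr_eq0 -lt0n; apply/card_gt0P.
  by exists x; rewrite inE Ax eqxx.
(* The ratio of class sizes is summed in both directions: since [r / s + s / r >= 2], the two bounds
   together control twice the number of related pairs. *)
have le1 := sum_cls_ratio rhoA
  (fun x y y' r r' => etrans (esym (rho_key _ _ _ _ r r')) (eqxx _)).
have le2 := @sum_cls_ratio (fun y x => rho x y)
  (fun y x r => etrans (andbC _ _) (rhoA _ _ r))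
  (fun y x x' r r' => etrans (rho_key _ _ _ _ r r') (eqxx _)).
rewrite [X in _ <= X]mulr_natl mulr2n; apply: le_trans (lerD le1 le2).
rewrite [X in _ <= _ + X](reindex_inj (inv_inj swap_pairK)) /= -big_split /=.
rewrite -sum1_card natr_sum mulr_sumr; apply: ler_sum => -[x y] /= rxy.
have /andP[/cls_neq0 cx /cls_neq0 cy] := rhoA _ _ rxy.
by rewrite mulr1; apply: two_le_ratio_sum; rewrite lt_neqAle eq_sym ?cx ?cy ler0n.
Qed.

End MatchedPairs.
End PairCounts.

(** * From the congruence modulo [p] to equality of rational fractions *)

Lemma frac_rigid (b c a1 b1 a2 b2 t : nat) : coprime c b ->
  (2 ^ t <= b)%N -> (2 ^ t <= b1 < 2 ^ t.+1)%N -> (2 ^ t <= b2 < 2 ^ t.+1)%N ->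
  (c * b1 + a2 * b = c * b2 + a1 * b)%N -> (a1, b1) = (a2, b2).
Proof.
wlog le_b : a1 b1 a2 b2 / (b1 <= b2)%N => [wl|].
  case: (leqP b1 b2) => [|/ltnW] le_b cop tb tb1 tb2 e; first exact: wl.
  exact/esym/wl.
move=> cop tb /andP[tb1 _] /andP[_]; rewrite expnS => tb2 e.
have b_gt0 : (0 < b)%N by apply: leq_trans tb; rewrite expn_gt0.
(* The equation reads [c (b2 - b1) = (a2 - a1) b], and [c] is prime to [b]. Two numbers of one
   dyadic interval differ by less than [2 ^ t <= b], so the divisibility forces [b1 = b2]. *)
have b_dvd : (b %| b2 - b1)%N.
  rewrite -(@Gauss_dvdr b c) 1?coprime_sym // mulnBr.
  have -> : (c * b2 - c * b1 = (a2 - a1) * b)%N by nia.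
  exact: dvdn_mull.
have b12 : b1 = b2.
  case: (posnP (b2 - b1)) => [|/dvdn_leq /(_ b_dvd)]; lia.
move: e; rewrite b12 => /eqP; rewrite eqn_add2l eqn_pmul2r // => /eqP ->.
by [].
Qed.

(** The difference [u - w] is [p] times the difference of the quotients; the shift by [M] keeps that
    difference a natural number. *)
Lemma modn_eq_quot (p M u w : nat) : u = w %[mod p] ->
  (u %/ p <= M)%N -> (w %/ p <= M)%N ->
  (u + M * p = w + (u %/ p + M - w %/ p) * p)%N.
Proof.
move=> cong uM wM; rewrite {1}(divn_eq u p) {1}(divn_eq w p) cong.
by move: (u %/ p)%N (w %/ p)%N (w %% p)%N uM wM {cong} => q q' r qM q'M; nia.
Qed.

Section Congruence.
Variables p k N : nat.
Hypotheses (p_pr : prime p) (k_gt0 : (0 < k)%N) (N_ge1 : (0 < N)%N) (Np : (N < p)%N).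

Let T := {ffun 'I_k -> 'I_N.+1}.
Let pos : pred T := fun x => [forall i, (0 < x i)%N].
Let frac (x : T) := recip_frac (fun i => nat_of_ord (x i)).
Let phi (x : T) : 'F_p := \sum_i ((x i)%:R)^-1.
Let L := trunc_log 2 N.
(** [D] is the number of dyadic levels, as denominators are at most [N ^ k < 2 ^ D]. [M] bounds
    [|lambda|], which leaves [2 * M + 1] values of [lambda]. *)
Let D := (k * L.+1)%N.
Let M := ((k * N ^ (2 * k - 1)) %/ p)%N.

Lemma posP (x : T) : reflect (forall i, (0 < x i)%N) (pos x).
Proof. exact: forallP. Qed.

Lemma J_le_pairs : (J p k N <= #|pairs_eq pos phi|)%N.
Proof.
pose h (x : {ffun 'I_(k + k) -> 'I_N.+1}) : T * T :=
  ([ffun i => x (lshift k i)], [ffun i => x (rshift k i)]).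
have h_inj : injective h.
  move=> x y [/ffunP hl /ffunP hr]; apply/ffunP => i.
  rewrite -(splitK i); case: (fintype.split i) => j /=.
    by have := hl j; rewrite !ffunE.
  by have := hr j; rewrite !ffunE.
rewrite /J -(card_imset _ h_inj); apply/subset_leq_card/fintype.subsetP => z.
case/imsetP => x; rewrite inE => /andP[/forallP x_range /eqP x_sum] ->.
rewrite inE /=; apply/and3P; split.
- by apply/posP => i; rewrite ffunE; case/andP: (x_range (lshift k i)).
- by apply/posP => i; rewrite ffunE; case/andP: (x_range (rshift k i)).
- apply/eqP; rewrite /phi.
  under eq_bigr do rewrite ffunE; rewrite x_sum.
  by apply: eq_bigr => i _; rewrite ffunE.
Qed.

Lemma Fp_nat_eq0 (m : nat) : (m%:R == 0 :> 'F_p) = (p %| m)%N.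
Proof. by rewrite (dvdn_pcharf (pchar_Fp p_pr)). Qed.

Lemma Fp_ord_neq0 (x : T) i : pos x -> (x i)%:R != 0 :> 'F_p.
Proof.
move=> /posP x_gt0; rewrite Fp_nat_eq0 gtnNdvd //.
exact: leq_trans (ltn_ord _) Np.
Qed.

Lemma frac_den_neq0 (x : T) : pos x -> (frac x).2%:R != 0 :> 'F_p.
Proof.
move=> x_pos; rewrite Fp_nat_eq0; apply/negP => p_dvd.
have : (p %| recip_den (fun i => x i : nat))%N.
  by apply: dvdn_trans p_dvd _; exact: (recip_frac_den_dvd (posP _ x_pos)).
rewrite -Fp_nat_eq0 natr_prod; apply/negP/prodf_neq0 => i _.
exact: Fp_ord_neq0.
Qed.

Lemma frac_cong (x y : T) : pos x -> pos y -> phi x = phi y ->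
  ((frac x).1 * (frac y).2 = (frac y).1 * (frac x).2 %[mod p])%N.
Proof.
move=> x_pos y_pos.
rewrite /phi (sum_recip (posP _ x_pos)) => [|i]; last exact: Fp_ord_neq0.
rewrite (sum_recip (posP _ y_pos)) => [|i]; last exact: Fp_ord_neq0.
move/eqP; rewrite eqr_div ?frac_den_neq0 // -!natrM => /eqP/(congr1 val) /=.
by rewrite !val_Fp_nat.
Qed.

Lemma frac_cross_le (x y : T) : pos x -> pos y ->
  ((frac x).1 * (frac y).2 <= k * N ^ (2 * k - 1))%N.
Proof.
move=> /posP x_pos /posP y_pos.
have xN i : (x i <= N)%N by rewrite -ltnS.
have yN i : (y i <= N)%N by rewrite -ltnS.
have le_num := recip_frac_num_bound xN.
have le_den := recip_frac_den_le y_pos yN.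

apply: leq_trans (leq_mul le_num le_den) _.
rewrite card_ord -mulnA -expnD; apply: eq_leq; congr (_ * _ ^ _)%N; lia.
Qed.

(** [inord] requires a successor, hence [D.-1.+1], which equals [D] because [D] is positive. On
    positive tuples [inord] never takes its default value. *)
Let lev (x : T) : 'I_D.-1.+1 := inord (trunc_log 2 (frac x).2).

Lemma lev_bounds (x : T) : pos x ->
  (2 ^ lev x <= (frac x).2 < 2 ^ (lev x).+1)%N.
Proof.
move=> /posP x_pos; have xN i : (x i <= N)%N by rewrite -ltnS.
have b_gt0 := recip_frac_den_gt0 x_pos.
rewrite inordK; first exact: trunc_log_bounds.
rewrite prednK ?muln_gt0 ?k_gt0 // -(ltn_exp2l _ _ (isT : (1 < 2)%N)).
apply: leq_ltn_trans (trunc_logP (isT : (1 < 2)%N) b_gt0) _.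
apply: leq_ltn_trans (recip_frac_den_le x_pos xN) _.
rewrite card_ord /D mulnC expnM ltn_exp2r //.
exact: trunc_log_ltn.
Qed.

(** For a solution of the congruence this is [lambda + M]. *)
Let label (z : T * T) : 'I_(2 * M).+1 :=
  inord (((frac z.1).1 * (frac z.2).2) %/ p + M - ((frac z.2).1 * (frac z.1).2) %/ p).

Lemma labelE (x y : T) : pos x -> pos y -> phi x = phi y ->
  ((frac x).1 * (frac y).2 + M * p = (frac y).1 * (frac x).2 + label (x, y) * p)%N.
Proof.
move=> x_pos y_pos /(frac_cong x_pos y_pos) cong.
have qM := leq_div2r p (frac_cross_le x_pos y_pos).
have q'M := leq_div2r p (frac_cross_le y_pos x_pos).
rewrite /label inordK; first exact: modn_eq_quot.
by rewrite ltnS mul2n -addnn leq_subLR addnA leq_add2r (leq_trans qM) ?leq_addl.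
Qed.

(** Requiring equal levels costs [D], and fixing [lambda] costs [2 * M + 1]. In what remains
    [frac x] and [frac y] determine each other by [frac_rigid], so the matching bound applies with
    key [frac]. *)
Lemma card_J_le : (J p k N <= D * ((2 * M).+1 * #|pairs_eq pos frac|))%N.
Proof.
apply: leq_trans J_le_pairs _.
have D_gt0 : (0 < D)%N by rewrite muln_gt0 k_gt0.
apply: leq_trans (card_pairs_eq_split pos phi lev) _.
rewrite [X in (X * _ <= _)%N]prednK // leq_mul2l; apply/orP; right.
rewrite -sum1_card (partition_big label xpredT) //=.
rewrite -[X in (_ <= X * _)%N]card_ord -sum_nat_const; apply: leq_sum => l _.
rewrite sum1_card.
pose rho x y :=
  ((x, y) \in pairs_eq pos (fun x => (phi x, lev x))) && (label (x, y) == l).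
have rhoP x y : rho x y ->
    [/\ pos x, pos y, phi x = phi y, lev x = lev y & label (x, y) = l].
  by case/andP; rewrite inE /= => /and3P[-> -> /eqP[-> ->]] /eqP ->.
rewrite (eq_card (B := [pred z | rho z.1 z.2])) => [|[x y]]; last by rewrite !inE.
apply: card_matched_pairs => [x y /rhoP[-> ->] //|x x' y y' r r'].
have [x_pos y_pos e_phi e_lev e_lab] := rhoP _ _ r.
have [x_pos' y_pos' e_phi' e_lev' e_lab'] := rhoP _ _ r'.
have := labelE x_pos y_pos e_phi; have := labelE x_pos' y_pos' e_phi'.
rewrite e_lab e_lab' => e' e.
have := lev_bounds x_pos; have := lev_bounds x_pos'.
have := lev_bounds y_pos; have := lev_bounds y_pos'.
rewrite -e_lev -e_lev' => ty' ty tx' tx.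
have fracE z : frac z = ((frac z).1, (frac z).2) by case: (frac z).
have cop z : pos z -> coprime (frac z).1 (frac z).2.
  by move=> /posP z_pos; apply: recip_frac_coprime.
apply/eqP/eqP => e_frac.
  (* Equal fractions have equal levels, so the denominators of all four tuples lie in one dyadic
     interval. *)
  have e_l : lev x = lev x' by rewrite /lev e_frac.
  move: e e' ty ty' tx; rewrite -e_l -e_frac => e e' ty ty' /andP[tx _].
  rewrite (fracE y) (fracE y').
  by apply: (frac_rigid (cop _ x_pos) tx ty ty'); lia.
have e_l : lev x = lev x' by rewrite e_lev e_lev' /lev e_frac.
move: e e' ty tx tx'; rewrite -e_l -e_frac => e e' /andP[ty _] tx tx'.
rewrite (fracE x) (fracE x').
by apply: (frac_rigid (cop _ y_pos) ty tx tx'); lia.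
Qed.

End Congruence.

(** * Valuations in vanishing signed sums of reciprocals *)

Definition paired (I : finType) (v : I -> nat) : bool :=
  [forall i, v i == 0%N] ||
  [exists i, [exists j, [&& i != j, v i == v j & (0 < v i)%N]]].

(** After multiplication by [\prod_j z j], the term at [i] becomes [w i], whose valuation drops as
    that of [z i] grows. Were a positive maximum attained only at [i0], every other term would be
    divisible by a higher power of [q] than [w i0], and the sum could not vanish. *)
Lemma signed_recip_sum_paired (I : finType) (z : I -> nat) (s : I -> bool) (q : nat) :
    (forall i, (0 < z i)%N) -> \sum_i (-1) ^+ s i / (z i)%:R = 0 :> rat ->
  paired (fun i => logn q (z i)).
Proof.
move=> z_gt0 sum0; rewrite /paired; case: forallP => //= not0.
have [i1 vi1] : exists i1, (0 < logn q (z i1))%N.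
  case: (pickP (fun i => (0 < logn q (z i))%N)) => [i ?|none]; first by exists i.
  by case: not0 => i; rewrite -leqn0 leqNgt none.
have q_pr : prime q by move: vi1; rewrite logn_gt0 mem_primes => /and3P[].
pose v i := logn q (z i); pose w i := (\prod_(j | j != i) z j)%N.
have [i0 _ max_v] := @arg_maxnP _ i1 xpredT v isT.
have {}max_v j : (v j <= v i0)%N by apply: max_v.
apply/existsPn => nopair.
have vlt j : j != i0 -> (v j < v i0)%N.
  move=> ji0; rewrite ltn_neqAle max_v andbT.
  have /existsPn/(_ j) := nopair i0; rewrite !negb_and eq_sym ji0 /= eq_sym.
  by case/orP => //; rewrite -/(v i0) (leq_trans vi1 (max_v i1)).
have w_gt0 i : (0 < w i)%N by apply: prodn_gt0.
have vw i : (logn q (w i) + v i = logn q (\prod_j z j))%N.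
  by rewrite (bigD1 i) //= lognM ?z_gt0 ?w_gt0 // addnC.
pose d := ((q ^ (logn q (w i0)).+1)%N : int).
have dvd_w i : i != i0 -> (d %| (w i)%:Z)%Z.
  move=> ii0; rewrite dvdzE /= pfactor_dvdn //.
  by have := vlt _ ii0; have := vw i; have := vw i0; lia.
have sumZ : \sum_i (-1) ^+ s i * (w i)%:Z = 0.
  apply: (@intr_inj rat); rewrite rmorph_sum /=.
  transitivity ((\prod_j z j)%:R * \sum_i (-1) ^+ s i / (z i)%:R : rat); last first.
    by rewrite sum0 mulr0.
  rewrite mulr_sumr; apply: eq_bigr => i _.
  rewrite rmorphM rmorphXn rmorphN1 (bigD1 i) //= natrM.
  have : (z i)%:R != 0 :> rat by rewrite pnatr_eq0 -lt0n.
  move: (_ ^+ _) => e zi_neq0.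
  by field.
move: sumZ; rewrite (bigD1 i0) //= => /eqP; rewrite addr_eq0 => /eqP eZ.
have : (d %| (-1) ^+ s i0 * (w i0)%:Z)%Z.
  rewrite eZ rpredN; apply: rpred_sum => i ii0.
  by rewrite dvdz_mull // dvd_w.
by rewrite dvdzE abszMsign /= pfactor_dvdn // ltnn.
Qed.

(** * Tuples with paired valuations and their Euler product *)

Section PairedTuples.
Variable N : nat.

Definition paired_tuples (n : nat) :=
  [pred z : {ffun 'I_n -> 'I_N.+1} | [forall i, (0 < z i)%N] &&
    [forall q : 'I_N.+1, prime q ==> paired (fun i => logn q (z i))]].

(** Two tuples with equal fractions are concatenated; with sign [-1] on the second half the
    reciprocals sum to zero in [rat]. *)
Lemma card_pairs_eq_frac_le (k : nat) :
  (#|pairs_eq (fun x : {ffun 'I_k -> 'I_N.+1} => [forall i, (0 < x i)%N])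
      (fun x => recip_frac (fun i => nat_of_ord (x i)))| <=
   #|paired_tuples (k + k)|)%N.
Proof.
set P := pairs_eq _ _.
pose h (z : {ffun 'I_k -> 'I_N.+1} * {ffun 'I_k -> 'I_N.+1}) :
  {ffun 'I_(k + k) -> 'I_N.+1} :=
  [ffun i => match fintype.split i with inl j => z.1 j | inr j => z.2 j end].
have hl z i : h z (lshift k i) = z.1 i by rewrite ffunE (unsplitK (inl i)).
have hr z i : h z (rshift k i) = z.2 i by rewrite ffunE (unsplitK (inr i)).
have h_inj : injective h.
  move=> [x y] [x' y'] e; congr (_, _); apply/ffunP => i.
    by rewrite -[LHS](hl (x, y)) e hl.
  by rewrite -[LHS](hr (x, y)) e hr.
rewrite -(fintype.card_image h_inj P); apply/subset_leq_card/fintype.subsetP => z.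
case/fintype.imageP=> [[x y] xyP ->{z}]; move: xyP.
rewrite !inE /= => /and3P[/forallP x_gt0 /forallP y_gt0 /eqP e_frac].
have h_gt0 i : (0 < h (x, y) i)%N.
  by rewrite -(splitK i); case: (fintype.split i) => j /=; rewrite (hl, hr).
apply/andP; split; first exact/forallP.
apply/forallP => q; apply/implyP => _.
apply: (@signed_recip_sum_paired _ (fun i => nat_of_ord (h (x, y) i))
  (fun i => k <= i)%N) => //.
rewrite big_split_ord /=.
under eq_bigr do rewrite hl leqNgt ltn_ord expr0 mul1r.
under [X in _ + X]eq_bigr do rewrite hr leq_addr expr1 mulN1r.
rewrite sumrN (sum_recip x_gt0) => [|i]; last by rewrite pnatr_eq0 -lt0n.
rewrite (sum_recip y_gt0) => [|i]; last by rewrite pnatr_eq0 -lt0n.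
by rewrite e_frac subrr.
Qed.

Lemma nat_prod_primes (m : nat) : (0 < m <= N)%N ->
  m = (\prod_(q < N.+1 | prime q) q ^ logn q m)%N.
Proof.
case/andP => m_gt0 mN; rewrite -[LHS](partnT m_gt0) (widen_partn _ mN) big_mkord.
rewrite [RHS]big_mkcond /=; apply: eq_bigr => q _.
by case: ifPn => // q_npr; rewrite lognE (negbTE q_npr).
Qed.

Section RealWeights.
Variable R : realType.

(** The Euler factor at a prime [q], used with [s = q ^ (-1/2)]. Exponents can be capped at [N]
    because [logn q m < m <= N]. *)
Definition local_factor (n : nat) (s : R) : R :=
  \sum_(v : {ffun 'I_n -> 'I_N.+1} | paired (fun i => nat_of_ord (v i)))
    \prod_i s ^+ v i.

Lemma sqrt_prod_primes (m : nat) : (0 < m <= N)%N ->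
  Num.sqrt (m%:R : R) = \prod_(q < N.+1 | prime q) Num.sqrt q%:R ^+ logn q m.
Proof.
move=> m_range; set Y := RHS.
have Y_ge0 : 0 <= Y by apply: prodr_ge0 => q _; rewrite exprn_ge0 // sqrtr_ge0.
rewrite -(ger0_norm Y_ge0) -sqrtr_sqr; congr Num.sqrt.
rewrite {1}(nat_prod_primes m_range) natr_prod /Y -prodrXl; apply: eq_bigr => q _.
by rewrite natrX exprAC sqr_sqrtr ?ler0n.
Qed.

(* Rankin's trick with exponent 1/2: a tuple of total size at most [N ^ n] has
   weight [\prod_i sqrt (N / z i) >= 1], and the valuation condition is local. *)
Lemma card_paired_tuples_le (n : nat) :
  #|paired_tuples n|%:R <=
    Num.sqrt (N%:R : R) ^+ n *
    \prod_(q < N.+1 | prime q) local_factor n (Num.sqrt q%:R)^-1.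
Proof.
pose s (q : 'I_N.+1) : R := (Num.sqrt q%:R)^-1.
pose W (q : 'I_N.+1) (v : {ffun 'I_n -> 'I_N.+1}) := \prod_i s q ^+ v i.
(* [v0] is the default value at non-prime indices, as the expansion of a product of sums into a sum
   over [pfamily] demands. *)
pose v0 : {ffun 'I_n -> 'I_N.+1} := [ffun=> ord0].
pose h (z : {ffun 'I_n -> 'I_N.+1}) : {ffun 'I_N.+1 -> {ffun 'I_n -> 'I_N.+1}} :=
  [ffun q : 'I_N.+1 => if prime q then [ffun i => inord (logn q (z i))] else v0].
have hE (z : {ffun 'I_n -> 'I_N.+1}) (q : 'I_N.+1) i :
    prime q -> (0 < z i)%N -> h z q i = logn q (z i) :> nat.
  move=> q_pr zi_gt0; rewrite !ffunE q_pr ffunE inordK // ltnS.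
  by rewrite ltnW // (leq_trans (ltn_logl _ zi_gt0)) // -ltnS.
have z_range (z : {ffun 'I_n -> 'I_N.+1}) i : (0 < z i)%N -> (0 < z i <= N)%N.
  by move=> ->; rewrite -ltnS ltn_ord.
have s_ge0 q : 0 <= s q by rewrite invr_ge0 sqrtr_ge0.
have W_ge0 q v : 0 <= W q v by apply: prodr_ge0 => i _; rewrite exprn_ge0.
have h_inj : {in paired_tuples n &, injective h}.
  move=> z z' /andP[/forallP z_gt0 _] /andP[/forallP z'_gt0 _] e.
  apply/ffunP => i; apply: val_inj => /=.
  rewrite [LHS]nat_prod_primes ?z_range // [RHS]nat_prod_primes ?z_range //.
  by apply: eq_bigr => q q_pr; rewrite -(hE z) // e hE.
rewrite /local_factor (big_distr_big_dep v0) /=.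
have weight z : z \in paired_tuples n ->
    1 <= Num.sqrt (N%:R : R) ^+ n * \prod_(q < N.+1 | prime q) W q (h z q).
  case/andP => /forallP z_gt0 _; rewrite /W exchange_big /=.
  rewrite -[X in _ ^+ X]card_ord -prodr_const -big_split /=.
  rewrite [leLHS](_ : 1 = \prod_(i < n) 1); last by rewrite big1.
  apply: ler_prod => i _; rewrite ler01 /=.
  rewrite (eq_bigr (fun q : 'I_N.+1 => (Num.sqrt (q%:R : R) ^+ logn q (z i))^-1)); last first.
    by move=> q q_pr; rewrite hE // exprVn.
  rewrite prodfV -sqrt_prod_primes ?z_range //.
  rewrite ler_pdivlMr ?sqrtr_gt0 ?ltr0n // mul1r ler_wsqrtr // ler_nat -ltnS //.
apply: (@le_trans _ _ (\sum_(z in paired_tuples n)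
    Num.sqrt (N%:R : R) ^+ n * \prod_(q < N.+1 | prime q) W q (h z q))).
  by rewrite -sum1_card natr_sum; apply: ler_sum.
(* The expanded product runs over all choices of paired valuation vectors; by injectivity of [h] the
   tuples give a subfamily of them, and the other terms are nonnegative. *)
rewrite -mulr_sumr ler_wpM2l ?exprn_ge0 ?sqrtr_ge0 //.
rewrite -(big_imset (fun f : {ffun 'I_N.+1 -> {ffun 'I_n -> 'I_N.+1}} =>
  \prod_(q < N.+1 | prime q) W q (f q)) h_inj) /=.
rewrite [leLHS]big_mkcond [leRHS]big_mkcond; apply: ler_sum => f _.
have prod_ge0 : 0 <= \prod_(q < N.+1 | prime q) W q (f q) by apply: prodr_ge0.
case: ifPn => [/imsetP[z z_in ef]|_]; last by case: ifP.
rewrite ifT //; case/andP: z_in => /forallP z_gt0 /forallP z_paired.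
apply/pfamilyP; split.
  by apply/supportP => q; rewrite ef ffunE unfold_in => /negbTE ->.
move=> q; rewrite ef unfold_in => q_pr.
have := implyP (z_paired q) q_pr; rewrite /paired unfold_in.
congr (_ || _).
  by apply: eq_forallb => i; rewrite hE.
by apply: eq_existsb => i; apply: eq_existsb => j; rewrite !hE.
Qed.

End RealWeights.
End PairedTuples.

(** * Bounds for one local factor *)

Section LocalFactor.
Variables (R : realType) (N n : nat) (s : R).
Hypotheses (s_ge0 : 0 <= s) (s_lt1 : s < 1).

Lemma sum_expr_le (m : nat) : \sum_(i < m) s ^+ i <= (1 - s)^-1.
Proof.
have s1_gt0 : 0 < 1 - s by rewrite subr_gt0.
rewrite -(ler_pM2l s1_gt0) mulfV ?gt_eqF //.
have -> : (1 - s) * \sum_(i < m) s ^+ i = 1 - s ^+ m.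
  by rewrite -opprB mulNr -subrX1 opprB.
by rewrite gerBl exprn_ge0.
Qed.

Lemma prod_expr_ge0 (v : {ffun 'I_n -> 'I_N.+1}) : 0 <= \prod_i s ^+ v i.
Proof. by apply: prodr_ge0 => i _; rewrite exprn_ge0. Qed.

(** Without the pairing condition the sum factors into [n] truncated geometric series. *)
Lemma local_factor_le_geom : local_factor N n s <= (1 - s)^-1 ^+ n.
Proof.
apply: (@le_trans _ _ (\sum_(v : {ffun 'I_n -> 'I_N.+1}) \prod_i s ^+ v i)).
  rewrite /local_factor big_mkcond; apply: ler_sum => v _.
  by case: ifP => // _; apply: prod_expr_ge0.
rewrite -(bigA_distr_bigA (fun (_ : 'I_n) (u : 'I_N.+1) => s ^+ u)).
rewrite prodr_const card_ord; apply: lerXn2r; last exact: sum_expr_le.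
  by rewrite nnegrE sumr_ge0 // => u _; rewrite exprn_ge0.
by rewrite nnegrE invr_ge0 subr_ge0 ltW.
Qed.

(** A common value [u > 0] at [i] and [j] gives [s ^ (2 u) <= s ^ (u + 1)], which again sums to a
    geometric series starting at [s ^ 2]; the other [n - 2] coordinates are free. *)
Lemma sum_equal_pair_le (i j : 'I_n) : i != j ->
  \sum_(v : {ffun 'I_n -> 'I_N.+1} | (v i == v j) && (0 < v i)%N) \prod_l s ^+ v l
    <= s ^+ 2 * (1 - s)^-1 ^+ n.-1.
Proof.
move=> ij; rewrite (partition_big (fun v : {ffun 'I_n -> 'I_N.+1} => v i)
  (fun u => (0 < u)%N)) => [|v /andP[_ ->] //].
have n_ge2 : (1 < n)%N.
  by move: ij (ltn_ord i) (ltn_ord j); rewrite -val_eqE /=; lia.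
have inv_ge0 : 0 <= (1 - s)^-1 by rewrite invr_ge0 subr_ge0 ltW.
apply: (@le_trans _ _ (\sum_(u < N.+1 | (0 < u)%N) s ^+ u.+1 * (1 - s)^-1 ^+ n.-2)).
  apply: ler_sum => u u_gt0.
  pose Q (l : 'I_n) (w : 'I_N.+1) := (l \in [:: i; j]) ==> (w == u).
  rewrite (eq_bigl (fun v : {ffun 'I_n -> 'I_N.+1} => v \in family Q)); last first.
    move=> v; apply/andP/familyP => [[/andP[/eqP vij _] /eqP vi] l|vQ].
      rewrite unfold_in; apply/implyP; rewrite !inE => /orP[] /eqP ->.
        by rewrite vi.
      by rewrite -vij vi.
    have vQu l : l \in [:: i; j] -> v l == u by have : Q l (v l) := vQ l; move/implyP.
    have := vQu i; have := vQu j; rewrite !inE !eqxx orbT.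
    move=> /(_ isT)/eqP -> /(_ isT)/eqP ->.
    by rewrite !eqxx.
  rewrite -(bigA_distr_big_dep Q (fun (_ : 'I_n) (w : 'I_N.+1) => s ^+ w)).
  rewrite (bigD1 i) //= (bigD1 j) 1?eq_sym //= mulrA.
  have sumQ l : l \in [:: i; j] -> \sum_(w | Q l w) s ^+ w = s ^+ u.
    by move=> l_ij; rewrite (big_pred1 u) // => w; rewrite /Q l_ij.
  rewrite !sumQ ?inE ?eqxx ?orbT // -exprD.
  apply: ler_pM; rewrite ?exprn_ge0 //.
  - by apply: prodr_ge0 => l _; apply: sumr_ge0 => w _; rewrite exprn_ge0.
  - by apply: ler_wiXn2l; rewrite ?(ltW s_lt1) // -addn1 leq_add2l.
  have -> : n.-2 = #|[pred l : 'I_n | (l != i) && (l != j)]|.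
    have := cardC (pred2 i j); rewrite card2 ij card_ord.
    move=> /(congr1 (fun m => m - 2)%N).
    rewrite addKn subn2 => <-; apply: eq_card => l; rewrite !inE negb_or //.
  rewrite -prodr_const; apply: ler_prod => l /andP[li lj].
  rewrite sumr_ge0 => [|w _]; last by rewrite exprn_ge0.
  rewrite (eq_bigl xpredT) => [|w]; last by rewrite /Q !inE (negbTE li) (negbTE lj).
  exact: sum_expr_le.
rewrite [in leRHS](_ : n.-1 = n.-2.+1); last by lia.
rewrite -mulr_suml (exprS (1 - s)^-1) mulrA ler_wpM2r ?exprn_ge0 //.
rewrite big_mkcond big_ord_recl /= add0r.
rewrite (eq_bigr (fun u : 'I_N => s ^+ 2 * s ^+ u)) => [|u _]; last first.
  by rewrite -exprD /bump leq0n.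
by rewrite -mulr_sumr ler_wpM2l ?exprn_ge0 // sum_expr_le.
Qed.

(** The zero vector contributes 1; any other paired vector has equal positive entries at some
    [i < j], and a union bound over these pairs applies. *)
Lemma local_factor_le_pairs :
  local_factor N n s <= 1 + 'C(n, 2)%:R * (s ^+ 2 * (1 - s)^-1 ^+ n.-1).
Proof.
pose v0 : {ffun 'I_n -> 'I_N.+1} := [ffun=> ord0].
pose eqpos (v : {ffun 'I_n -> 'I_N.+1}) (i j : 'I_n) := (v i == v j) && (0 < v i)%N.
have pairE (v : {ffun 'I_n -> 'I_N.+1}) : paired (fun i => nat_of_ord (v i)) ->
    v != v0 -> exists i j : 'I_n, (i < j)%N /\ eqpos v i j.
  case/orP => [/forallP v_eq0 /eqP[]|]; last first.
    case/existsP => i /existsP[j /and3P[ij /eqP vij vi_gt0]] _.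
    have e : v i = v j by apply: val_inj.
    have [lij|lji|/val_inj eij] := ltngtP i j.
    - by exists i, j; rewrite /eqpos e eqxx -e vi_gt0.
    - by exists j, i; rewrite /eqpos e eqxx -e vi_gt0.
    - by rewrite eij eqxx in ij.
  by apply/ffunP => i; rewrite ffunE; apply: val_inj; apply/eqP; apply: v_eq0.
have -> : 'C(n, 2)%:R = \sum_(j < n) \sum_(i < n | (i < j)%N) 1 :> R.
  rewrite -bin2_sum big_mkord natr_sum; apply: eq_bigr => j _.
  by rewrite (big_ord_narrow (ltnW (ltn_ord j))) sumr_const card_ord.
rewrite mulr_suml.
apply: (@le_trans _ _ (1 + \sum_(j < n) \sum_(i < n | (i < j)%N)
    \sum_(v : {ffun 'I_n -> 'I_N.+1} | eqpos v i j) \prod_l s ^+ v l)); last first.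
  rewrite lerD2l; apply: ler_sum => j _; rewrite mulr_suml.
  apply: ler_sum => i lij; rewrite mul1r; apply: sum_equal_pair_le.
  by rewrite -val_eqE ltn_eqF.
rewrite /local_factor (bigD1 v0) /=; last first.
  by apply/orP; left; apply/forallP => i; rewrite ffunE.
rewrite big1 => [|l _]; last by rewrite ffunE expr0.
rewrite lerD2l.
under [leRHS]eq_bigr do under eq_bigr do rewrite big_mkcond.
under [leRHS]eq_bigr do rewrite exchange_big.
rewrite exchange_big big_mkcond /=; apply: ler_sum => v _.
have term_ge0 i j : 0 <= (if eqpos v i j then \prod_l s ^+ v l else 0).
  by case: ifP => // _; apply: prod_expr_ge0.
case: ifP => [/andP[v_paired v_neq0]|_]; last first.
  by apply: sumr_ge0 => j _; apply: sumr_ge0.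
have [i [j [lij vij]]] := pairE v v_paired v_neq0.
rewrite [leRHS](bigD1 j) //= [X in _ <= X + _](bigD1 i) //= vij -addrA lerDl addr_ge0 //.
  by apply: sumr_ge0.
by apply: sumr_ge0 => l _; apply: sumr_ge0.
Qed.

(** With [y = n s <= 1/2], Bernoulli's inequality gives [(1 - s) ^ (n - 1) >= 1 - y], and
    [1 / (1 - y) <= 1 + 2 y]; then [1 + x <= exp x]. *)
Lemma local_factor_le_exp : 2 * n%:R * s <= 1 ->
  local_factor N n s <= expR ('C(n, 2)%:R * (s ^+ 2 + 2 * n%:R * s ^+ 3)).
Proof.
move=> ns_le1; apply: le_trans (expR_ge1Dx _).
apply: le_trans local_factor_le_pairs _; rewrite lerD2l ler_wpM2l ?ler0n //.
have -> : s ^+ 2 + 2 * n%:R * s ^+ 3 = s ^+ 2 * (1 + 2 * (n%:R * s)) by ring.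
rewrite ler_wpM2l ?exprn_ge0 //.
have bernoulli m : 1 - m%:R * s <= (1 - s) ^+ m.
  elim: m => [|m IHm]; first by rewrite mul0r subr0 expr0.
  have IHs : (1 - s) * (1 - m%:R * s) <= (1 - s) ^+ m.+1.
    by rewrite exprS ler_wpM2l // subr_ge0 ltW.
  apply: le_trans IHs; have := mulr_ge0 (ler0n R m) (mulr_ge0 s_ge0 s_ge0).
  rewrite -natr1; nra.
have le_pow : 1 - n%:R * s <= (1 - s) ^+ n.-1.
  by apply: le_trans (bernoulli _); rewrite lerB // ler_wpM2r // ler_nat leq_pred.
have ns_ge0 : 0 <= n%:R * s by rewrite mulr_ge0.
rewrite exprVn invf_ple ?posrE ?exprn_gt0 ?subr_gt0 //; last by nra.
apply: le_trans le_pow; rewrite -div1r ler_pdivrMr; nra.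
Qed.


End LocalFactor.

(** * Chebyshev's bound, sums and products over primes *)

Lemma central_bin_le (n : nat) : ('C(2 * n, n) <= 2 ^ (2 * n))%N.
Proof.
have := expnDn 1 1 (2 * n); rewrite addn1 => ->.
have n_lt : (n < (2 * n).+1)%N by lia.
by rewrite (bigD1 (Ordinal n_lt)) //= !exp1n !muln1 leq_addr.
Qed.

Lemma prime_dvd_central_bin (n q : nat) : prime q -> (n < q <= 2 * n)%N ->
  (q %| 'C(2 * n, n))%N.
Proof.
move=> q_pr /andP[nq qn].
have q_fact : (q %| 'C(2 * n, n) * (n`! * (2 * n - n)`!))%N.
  by rewrite bin_fact ?leq_pmull // dvdn_fact // prime_gt0.
have q_nfact : ~~ (q %| n`!)%N.
  elim: n nq {qn q_fact} => [|m IHm] mq; first by rewrite Euclid_dvd1.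
  by rewrite factS Euclid_dvdM // negb_or gtnNdvd // IHm // ltnW.
move: q_fact; rewrite (_ : 2 * n - n = n)%N; last by lia.
by rewrite !Euclid_dvdM // (negbTE q_nfact) !orbF.
Qed.

(* Chebyshev: the product of the primes in [(n, 2n]] divides the central
   binomial coefficient. *)
Lemma expn_primes_le (n : nat) : (0 < n)%N ->
  (n ^ (\sum_(n.+1 <= q < (2 * n).+1 | prime q) 1) <= 2 ^ (2 * n))%N.
Proof.
move=> n_gt0; apply: leq_trans (central_bin_le n).
set m := 'C(_, _); have m_gt0 : (0 < m)%N by rewrite bin_gt0 leq_pmull.
pose pi := [pred q | prime q & (n < q <= 2 * n)%N] : nat_pred.
apply: leq_trans (dvdn_leq m_gt0 (dvdn_part pi m)).
rewrite (widen_partn pi (leq_maxl m (2 * n))).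
rewrite (big_morph (expn n) (expnD n) (expn0 n)) (big_nat_widenl _ 0) //.
rewrite (@big_nat_widen _ _ _ _ _ (maxn m (2 * n)).+1) ?ltnS ?leq_maxr //.
rewrite (eq_bigl (fun q => q \in pi)) => [|q]; last by rewrite inE ltnS andbA.
apply: leq_prod => q; rewrite inE => /andP[q_pr q_range].
have [nq _] := andP q_range.
apply: leq_trans (ltnW nq) _; rewrite -{1}(expn1 q) leq_pexp2l ?(prime_gt0 q_pr) //.
by rewrite logn_gt0 mem_primes q_pr m_gt0 prime_dvd_central_bin.
Qed.

Section PrimeSums.
Variable R : realType.

Let sqrtn (q : nat) : R := Num.sqrt q%:R.

(** By [expn_primes_le] the block holds at most [2 ^ (j + 2) / (j + 1)] primes, each with reciprocal
    at most [2 ^ -(j + 1)]. *)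
Lemma sum_inv_primes_block (j : nat) :
  \sum_((2 ^ j.+1).+1 <= q < (2 ^ j.+2).+1 | prime q) (q%:R : R)^-1 <= 2 / j.+1%:R.
Proof.
set c := (\sum_((2 ^ j.+1).+1 <= q < (2 ^ j.+2).+1 | prime q) 1)%N.
have c_le : (c * j.+1 <= 2 ^ j.+2)%N.
  have := @expn_primes_le (2 ^ j.+1)%N; rewrite expn_gt0 -expnS -/c => /(_ isT).
  by rewrite -expnM leq_exp2l // mulnC.
apply: (@le_trans _ _ (c%:R / (2 ^ j.+1)%:R)).
  rewrite /c natr_sum mulr_suml [leLHS]big_nat_cond [leRHS]big_nat_cond.
  apply: ler_sum => q /andP[/andP[q_gt _] _].
  rewrite mul1r lef_pV2 ?posrE ?ltr0n ?expn_gt0 //.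
    by rewrite ler_nat ltnW.
  exact: leq_ltn_trans q_gt.
rewrite ler_pdivrMr ?ltr0n ?expn_gt0 // mulrAC ler_pdivlMr ?ltr0n //.
by rewrite -!natrM ler_nat -expnS.
Qed.

(** The base case has [5 / 2 = 1 / 2 + 2], from the prime 2 and the block up to 4. Each further
    block multiplies by at most [exp (1 / (L + 2)) ^ 2], and
    [exp (1 / (L + 2)) <= (L + 2) / (L + 1)] telescopes. *)
Lemma exp_sum_inv_primes_pow (L : nat) :
  expR (\sum_(0 <= q < (2 ^ L.+2).+1 | prime q) (q%:R : R)^-1) <=
    expR (5 / 2) * L.+1%:R ^+ 2.
Proof.
have split_sum (J : nat) : \sum_(0 <= q < (2 ^ J.+2).+1 | prime q) (q%:R : R)^-1 <=
    \sum_(0 <= q < (2 ^ J.+1).+1 | prime q) (q%:R : R)^-1 + 2 / J.+1%:R.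
  rewrite (@big_cat_nat _ _ _ (2 ^ J.+1).+1) //= ?ltnS ?leq_exp2l //.
  by rewrite lerD2l sum_inv_primes_block.
elim: L => [|L IHL].
  rewrite expr1n mulr1 ler_expR; apply: le_trans (split_sum 0%N) _.
  rewrite expn1 big_mkcond !big_nat_recr //= big_geq //=; lra.
apply: (@le_trans _ _ (expR (5 / 2) * L.+1%:R ^+ 2 * expR (L.+2%:R^-1) ^+ 2)).
  rewrite -[expR _ ^+ 2]expRM_natl; apply: le_trans (ler_pM _ _ IHL (lexx _));
    rewrite ?expR_ge0 //.
  by rewrite -expRD ler_expR split_sum.
rewrite -mulrA -exprMn ler_wpM2l ?expR_ge0 //.
rewrite lerXn2r ?nnegrE ?mulr_ge0 ?expR_ge0 ?ler0n //.
have h := expR_ge1Dx (- L.+2%:R^-1 : R).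
rewrite expRN -[leRHS]div1r ler_pdivlMr ?expR_gt0 // in h.
have eL : L.+1%:R = L.+2%:R * (1 - L.+2%:R^-1) :> R.
  by rewrite mulrBr mulr1 mulfV ?pnatr_eq0 // -[L.+2%:R]natr1 addrK.
by rewrite eL -mulrA -[leRHS]mulr1 ler_pM2l ?ltr0n.
Qed.

Lemma exp_sum_inv_primes (N : nat) : (2 <= N)%N ->
  expR (\sum_(0 <= q < N.+1 | prime q) (q%:R : R)^-1) <=
    expR (5 / 2) * (trunc_log 2 N)%:R ^+ 2.
Proof.
move=> N_ge2; have L_gt0 : (0 < trunc_log 2 N)%N by rewrite trunc_log_gt0.
have := exp_sum_inv_primes_pow (trunc_log 2 N).-1; rewrite prednK //.
apply: le_trans; rewrite ler_expR.
have N_lt : (N.+1 <= (2 ^ (trunc_log 2 N).+1).+1)%N by rewrite ltnS ltnW // trunc_log_ltn.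
rewrite [leRHS](@big_cat_nat _ _ _ N.+1) //= lerDl.
by apply: sumr_ge0 => q _; rewrite invr_ge0 ler0n.
Qed.

Lemma sqrtn_gt0 (q : nat) : (0 < q)%N -> 0 < sqrtn q.
Proof. by move=> q_gt0; rewrite sqrtr_gt0 ltr0n. Qed.

Lemma sqr_sqrtn (q : nat) : sqrtn q ^+ 2 = q%:R.
Proof. by rewrite sqr_sqrtr ?ler0n. Qed.

Lemma sqrtnS_sqr (q : nat) : sqrtn q.+1 ^+ 2 = sqrtn q ^+ 2 + 1.
Proof. by rewrite !sqr_sqrtn natr1. Qed.

Lemma sqrtn_ltS (q : nat) : sqrtn q < sqrtn q.+1.
Proof. by rewrite ltr_sqrt ?ltr0n // ltr_nat. Qed.

(** For consecutive square roots [a < b] one has [b^2 - a^2 = 1], so [2 / a - 2 / b = 2 / (a b (a +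
    b)) >= 1 / b^3], and the sum telescopes. *)
Lemma sum_inv_cube_le (T d : nat) : (0 < T)%N ->
  \sum_(T.+1 <= q < (T + d).+1) (sqrtn q)^-1 ^+ 3 <= 2 / sqrtn T - 2 / sqrtn (T + d).
Proof.
move=> T_gt0; elim: d => [|d IHd].
  by rewrite addn0 big_geq // subrr.
rewrite addnS big_nat_recr ?leq_addr //=.
have sqS := sqrtnS_sqr (T + d); have lt := sqrtn_ltS (T + d).
have m_gt0 : 0 < sqrtn (T + d) by rewrite sqrtn_gt0 // ltn_addr.
move: (sqrtn (T + d)) (sqrtn (T + d).+1) sqS lt m_gt0 IHd => a b b2 ab a_gt0 IHd.
have b_gt0 : 0 < b by apply: lt_trans ab.
suff step : b^-1 ^+ 3 <= 2 / a - 2 / b by lra.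
have -> : 2 / a - 2 / b = 2 / (a * b * (a + b)).
  have -> : (2 : R) / (a * b * (a + b)) = 2 * (b ^+ 2 - a ^+ 2) / (a * b * (a + b)).
    by rewrite b2 addrAC subrr add0r mulr1.
  by field; rewrite !gt_eqF // addr_gt0.
have ab_gt0 : 0 < a * b * (a + b) by rewrite !mulr_gt0 // addr_gt0.
rewrite exprVn ler_pdivlMr // mulrC ler_pdivrMr ?exprn_gt0 //.
nra.
Qed.

(** Induction over all integers, non-primes contributing a factor 1. With consecutive square roots
    [a < b], [1 / (1 - 1/b) = (b^2 / a^2) (1 + 1/b)] and [1/b <= 2 (b - a)], so both the ratios and
    the exponents telescope. *)
Lemma prod_geom_le (T : nat) : (0 < T)%N ->
  \prod_(0 <= q < T.+1 | prime q) (1 - (sqrtn q)^-1)^-1 <= T%:R * expR (2 * sqrtn T).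
Proof.
case: T => // T _; elim: T => [|T IHT].
  rewrite big_mkcond !big_nat_recr //= big_geq //= !mul1r.
  by rewrite -expR0 ler_expR mulr_ge0 // sqrtr_ge0.
have sqS := sqrtnS_sqr T.+1; have lt := sqrtn_ltS T.+1.
have m_gt0 : 0 < sqrtn T.+1 by rewrite sqrtn_gt0.
rewrite big_mkcond big_nat_recr //= -big_mkcond -(sqr_sqrtn T.+2) /=.
rewrite -(sqr_sqrtn T.+1) in IHT.
have a_ge1 : 1 <= sqrtn T.+1 by rewrite -[leLHS]sqrtr1 ler_wsqrtr // ler1n.
move: (sqrtn T.+1) (sqrtn T.+2) sqS lt m_gt0 a_ge1 IHT => a b b2 ab a_gt0 a_ge1 IHT.
have b_gt0 : 0 < b by apply: lt_trans ab.
have b_gt1 : 1 < b by apply: le_lt_trans ab.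
have step : (1 - b^-1)^-1 <= b ^+ 2 / a ^+ 2 * expR (2 * b - 2 * a).
  have -> : (1 - b^-1)^-1 = b ^+ 2 / a ^+ 2 * (1 + b^-1).
    have -> : a ^+ 2 = b ^+ 2 - 1 by rewrite b2 addrK.
    by field; rewrite ?gt_eqF //; nra.
  rewrite ler_wpM2l ?divr_ge0 ?sqr_ge0 //; apply: le_trans (expR_ge1Dx _).
  rewrite lerD2l -div1r ler_pdivrMr //; nra.
have P_ge0 : 0 <= \prod_(0 <= q < T.+2 | prime q) (1 - (sqrtn q)^-1)^-1.
  rewrite big_nat_cond; apply: prodr_ge0 => q /andP[/andP[_ _] q_pr].
  rewrite invr_ge0 subr_ge0 invf_le1 ?sqrtn_gt0 ?prime_gt0 //.
  by rewrite -[leLHS]sqrtr1 ler_wsqrtr // ler1n prime_gt0.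
have -> : b ^+ 2 * expR (2 * b) =
    a ^+ 2 * expR (2 * a) * (b ^+ 2 / a ^+ 2 * expR (2 * b - 2 * a)).
  have -> : 2 * b = 2 * a + (2 * b - 2 * a) by rewrite addrC subrK.
  rewrite expRD addrAC subrr add0r; move: (expR _) (expR _) => u v.
  by field; rewrite gt_eqF.
apply: ler_pM => //.
  by case: ifP => // _; rewrite invr_ge0 subr_ge0 invf_le1 // ltW.
case: ifP => // _; apply: le_trans step.
rewrite -[leLHS]invr1 lef_pV2 ?posrE ?subr_gt0 ?invf_lt1 //.
by rewrite gerBl invr_ge0 ltW.
Qed.


End PrimeSums.

(** * The Euler product and the number of paired tuples *)

Section EulerProduct.
Variables (R : realType) (N : nat).

Let sqrtn (q : nat) : R := Num.sqrt q%:R.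
Let geom (q : nat) : R := (1 - (sqrtn q)^-1)^-1.

Lemma inv_sqrtn_lt1 (q : nat) : prime q -> (sqrtn q)^-1 < 1.
Proof.
move=> q_pr; rewrite invf_lt1 ?sqrtn_gt0 ?prime_gt0 //.
by rewrite -[ltLHS]sqrtr1 ltr_sqrt ?ltr0n ?ltr1n ?prime_gt1 ?prime_gt0.
Qed.

Lemma prod_small_primes_le (T : nat) : (0 < N)%N -> (0 < T)%N ->
  \prod_(0 <= q < N.+1 | prime q && (q <= T)%N) geom q <= T%:R * expR (2 * sqrtn T).
Proof.
move=> N_gt0 T_gt0; case: (leqP N T) => [NT|/ltnW TN].
  apply: (@le_trans _ _ (N%:R * expR (2 * sqrtn N))); last first.
    apply: ler_pM; rewrite ?expR_ge0 ?ler0n ?ler_nat ?ler_expR //.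
    by rewrite ler_wpM2l // ler_wsqrtr // ler_nat.
  rewrite [leLHS](_ : _ = \prod_(0 <= q < N.+1 | prime q) geom q) ?prod_geom_le //.
  rewrite [LHS]big_nat_cond [RHS]big_nat_cond; apply: eq_bigl => q.
  by rewrite ltnS leq0n /=; case: leqP => //= qN; rewrite (leq_trans qN NT) andbT.
apply: le_trans (prod_geom_le R T_gt0).
by rewrite [leRHS](@big_nat_widen _ _ _ _ _ N.+1).
Qed.

Lemma sum_large_cubes_le (T : nat) : (0 < T)%N ->
  \sum_(0 <= q < N.+1 | prime q && ~~ (q <= T)%N) (sqrtn q)^-1 ^+ 3 <= 2 / sqrtn T.
Proof.
move=> T_gt0.
have term_ge0 q : 0 <= (sqrtn q)^-1 ^+ 3 by rewrite exprn_ge0 // invr_ge0 sqrtr_ge0.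
have T_ge0 : 0 <= 2 / sqrtn T by rewrite divr_ge0 // sqrtr_ge0.
apply: (@le_trans _ _ (\sum_(T.+1 <= q < N.+1) (sqrtn q)^-1 ^+ 3)).
  rewrite [leRHS](big_nat_widenl _ 0) //= [leLHS]big_mkcond [leRHS]big_mkcond.
  apply: ler_sum => q _; rewrite -ltnNge.
  by case: (T < q)%N; rewrite ?andbT ?andbF //; case: ifP.
case: (leqP N T) => [NT|/ltnW TN]; first by rewrite big_geq.
rewrite -(subnKC TN); apply: le_trans (sum_inv_cube_le R _ T_gt0) _.
by rewrite gerBl divr_ge0 // sqrtr_ge0.
Qed.

(* Below the threshold [n ^ 4] the local factors are estimated trivially, at a
   total cost of [exp (O (n ^ 3))]; above it, [n / sqrt q <= 1 / n]. *)
Lemma prod_local_factor_le (n : nat) : (0 < N)%N -> (1 < n)%N ->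
  \prod_(q < N.+1 | prime q) local_factor N n (sqrtn q)^-1 <=
    ((n ^ 4)%:R * expR (2 * (n ^ 2)%:R)) ^+ n *
    expR ('C(n, 2)%:R * (\sum_(0 <= q < N.+1 | prime q) q%:R^-1 + 4 / n%:R)).
Proof.
move=> N_gt0 n_gt1; have n_gt0 := ltnW n_gt1.
rewrite -(big_mkord prime (fun q => local_factor N n (sqrtn q)^-1)).
pose T := (n ^ 4)%N; have T_gt0 : (0 < T)%N by rewrite expn_gt0 n_gt0.
have sqrtT : sqrtn T = (n ^ 2)%:R.
  by rewrite /sqrtn /T (expnM n 2 2) natrX sqrtr_sqr ger0_norm ?ler0n.
pose large q := 'C(n, 2)%:R * ((sqrtn q)^-1 ^+ 2 + 2 * n%:R * (sqrtn q)^-1 ^+ 3).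
apply: (@le_trans _ _ (\prod_(0 <= q < N.+1 | prime q)
    ((if (q <= T)%N then geom q ^+ n else 1) *
     (if ~~ (q <= T)%N then expR (large q) else 1)))).
  apply: ler_prod => q q_pr; apply/andP; split.
    by apply: sumr_ge0 => v _; apply: prod_expr_ge0; rewrite invr_ge0 sqrtr_ge0.
  have s_ge0 : 0 <= (sqrtn q)^-1 by rewrite invr_ge0 sqrtr_ge0.
  have s_lt1 := inv_sqrtn_lt1 q_pr.
  case: leqP => [_|Tq] /=; first by rewrite mulr1; exact: local_factor_le_geom.
  rewrite mul1r; apply: local_factor_le_exp => //.
  (* Here [2 n <= n ^ 2 <= sqrt q], which is the smallness condition of [local_factor_le_exp]. *)
  have q_large : (n ^ 2)%:R <= sqrtn q.
    by rewrite -sqrtT ler_wsqrtr // ler_nat ltnW.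
  rewrite ler_pdivrMr ?sqrtn_gt0 ?prime_gt0 // mul1r; apply: le_trans q_large.
  by rewrite -natrM ler_nat -mulnn leq_mul2r n_gt1 orbT.
rewrite big_split /= -!big_mkcondr /= prodrXl.
have geom_ge0 q : prime q -> 0 <= geom q.
  by move=> q_pr; rewrite invr_ge0 subr_ge0 ltW // inv_sqrtn_lt1.
apply: ler_pM.
- by apply: exprn_ge0; apply: prodr_ge0 => q /andP[q_pr _]; apply: geom_ge0.
- by apply: prodr_ge0 => q _; apply: expR_ge0.
- rewrite -sqrtT lerXn2r ?nnegrE ?mulr_ge0 ?ler0n ?expR_ge0 ?prod_small_primes_le //.
  by apply: prodr_ge0 => q /andP[q_pr _]; apply: geom_ge0.
rewrite -(big_morph expR (@expRD R) (@expR0 R)) ler_expR -mulr_sumr.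
rewrite ler_wpM2l ?ler0n // big_split /= lerD //.
  rewrite [leLHS]big_mkcond [leRHS]big_mkcond; apply: ler_sum => q _.
  rewrite exprVn sqr_sqrtn.
  by case: prime => //=; case: ifP => // _; rewrite invr_ge0 ler0n.
rewrite -mulr_sumr; apply: (@le_trans _ _ (2 * n%:R * (2 / sqrtn T))).
  by rewrite ler_wpM2l ?mulr_ge0 ?ler0n // sum_large_cubes_le.
have n_neq0 : n%:R != 0 :> R by rewrite pnatr_eq0 -lt0n.
by rewrite sqrtT natrX le_eqVlt; apply/orP; left; apply/eqP; field.
Qed.

(** From [exp (-1/2) >= 1/2]. It yields both [e <= 4] and the comparison of [trunc_log 2 N] with
    [2 ln N]. *)
Lemma expR_half_le : expR (2^-1 : R) <= 2.
Proof.
have := expR_ge1Dx (- 2^-1 : R); rewrite expRN.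
have : 0 < expR (2^-1 : R) by apply: expR_gt0.
move: (expR _) => e e_gt0; rewrite -[leRHS]div1r ler_pdivlMr //; lra.
Qed.

Lemma expR_natr_le (m : nat) : expR (m%:R : R) <= (4 ^ m)%:R.
Proof.
rewrite -[m%:R]mulr1 expRM_natl natrX lerXn2r ?nnegrE ?expR_ge0 ?ler0n //.
rewrite [X in expR X](_ : 1 = 2%:R * 2^-1); last first.
  by rewrite mulfV ?pnatr_eq0.
rewrite expRM_natl -[4%N]/(2 ^ 2)%N natrX.
by rewrite lerXn2r ?nnegrE ?expR_ge0 ?ler0n ?expR_half_le.
Qed.

Lemma trunc_log_le_ln : (0 < N)%N -> (trunc_log 2 N)%:R <= 2 * ln (N%:R : R).
Proof.
move=> N_gt0; rewrite -ler_pdivrMl // -ler_expR lnK ?posrE ?ltr0n //.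
rewrite mulrC expRM_natl.
apply: (@le_trans _ _ (2 ^+ trunc_log 2 N)).
  by rewrite lerXn2r ?nnegrE ?expR_ge0 ?ler0n ?expR_half_le.
by rewrite -natrX ler_nat trunc_logP.
Qed.

Lemma card_paired_tuples_le_log (k : nat) : (2 <= N)%N -> (0 < k)%N ->
  #|paired_tuples N (k + k)|%:R <=
    N%:R ^+ k * (k + k)%:R ^+ (4 * (k + k) + 9 * (k + k) ^ 3) *
    (trunc_log 2 N)%:R ^+ ((k + k) * (k + k).-1) :> R.
Proof.
move=> N_ge2 k_gt0; have N_gt0 := ltnW N_ge2.
set n := (k + k)%N; have n_gt1 : (1 < n)%N by rewrite /n; lia.
have n_neq0 : n%:R != 0 :> R by rewrite pnatr_eq0; lia.
have binE : ('C(n, 2) * 2 = n * n.-1)%N.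
  by rewrite -[X in (_ * X)%N]/(2`!) bin_ffact ffactnS ffactn1.
apply: le_trans (card_paired_tuples_le _ _ _) _.
rewrite {1}/n exprD -exprMn -expr2 sqr_sqrtn -mulrA ler_wpM2l ?exprn_ge0 ?ler0n //.
move: n n_gt1 n_neq0 binE => n n_gt1 n_neq0 binE.
apply: le_trans (prod_local_factor_le N_gt0 n_gt1) _.
set L := trunc_log 2 N; set S := \sum_(_ <= _ < _ | _) _.
(* [m] dominates the sum of all exponents free of [S], so their total contribution is at most
   [4 ^ m <= n ^ (2 m)], and [2 m <= 9 n ^ 3]. The power of [L] is [2 C = n (n - 1)]. *)
set C := 'C(n, 2); pose m := (2 * n ^ 3 + 2 * n ^ 2 + 2 * n)%N.
have exp_S : expR (C%:R * S) <= expR (C%:R * (5 / 2)) * L%:R ^+ (n * n.-1).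
  rewrite -binE mulnC exprM (expRM_natl C S) (expRM_natl C (5 / 2)) -exprMn.
  rewrite lerXn2r ?nnegrE ?mulr_ge0 ?expR_ge0 ?sqr_ge0 //.
  exact: exp_sum_inv_primes.
have exp_le : expR (n%:R * (2 * (n ^ 2)%:R)) * expR (C%:R * (4 / n%:R)) *
    expR (C%:R * (5 / 2)) <= (n%:R : R) ^+ (2 * m).
  rewrite -!expRD; apply: (@le_trans _ _ (expR m%:R)).
    rewrite ler_expR natrX.
    have -> : m%:R = 2 * n%:R ^+ 3 + 2 * n%:R ^+ 2 + 2 * n%:R :> R by rewrite /m; ring.
    have C2 : C%:R * 2 = n%:R * (n%:R - 1) :> R.
      by rewrite -natrM binE natrM -subn1 natrB // ltnW.
    have C4 : C%:R * (4 / n%:R) = 2 * (n%:R - 1) :> R.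
      have -> : C%:R = n%:R * (n%:R - 1) / 2 :> R by lra.
      by field.
    by rewrite C4; have : (1 : R) < n%:R; [rewrite ltr1n|nra].
  apply: le_trans (expR_natr_le m) _; rewrite natrX (exprM n%:R).
  rewrite lerXn2r ?nnegrE ?exprn_ge0 ?ler0n // -natrX ler_nat.
  by rewrite (@leq_exp2r 2 n 2).
apply: (@le_trans _ _ ((n%:R : R) ^+ (4 * n) * n%:R ^+ (2 * m) * L%:R ^+ (n * n.-1))).
  rewrite natrX exprMn -exprM -!mulrA ler_wpM2l ?exprn_ge0 ?ler0n //.
  rewrite -expRM_natl mulrDr expRD.
  apply: (@le_trans _ _ (expR (n%:R * (2 * (n ^ 2)%:R)) * (expR (C%:R * (5 / 2)) *
      L%:R ^+ (n * n.-1) * expR (C%:R * (4 / n%:R))))).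
    by rewrite ler_wpM2l ?expR_ge0 // ler_wpM2r ?expR_ge0.
  have -> a b c d : a * (c * d * b) = a * b * c * d :> R by ring.
  by rewrite ler_wpM2r ?exprn_ge0 ?ler0n.
rewrite ler_wpM2r ?exprn_ge0 ?ler0n // -exprD ler_weXn2l ?ler1n //; first by lia.
rewrite leq_add2l /m; nia.
Qed.

End EulerProduct.

(** * Assembly of the final bound *)

Theorem theorem5 (R : realType) :
  exists p0 : nat, forall p k N : nat,
    prime p -> (p0 <= p)%N -> (0 < k)%N -> (2 <= N < p)%N ->
    (J p k N)%:R <
      (2 * k)%:R ^+ (90 * k ^ 3) * ln (N%:R : R) ^+ (4 * k ^ 2)
        * (N%:R ^+ (2 * k - 1) / p%:R + 1) * N%:R ^+ k.
Proof.
exists 0%N => p k N p_pr _ k_gt0 /andP[N_ge2 Np].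
have N_gt0 := ltnW N_ge2.
set Y := _ / _ + 1.
have p_gt0 : (0 : R) < p%:R by rewrite ltr0n prime_gt0.
have Y_ge1 : 1 <= Y by rewrite lerDr divr_ge0 ?exprn_ge0 ?ler0n.
pose L := trunc_log 2 N; have L_gt0 : (0 < L)%N by rewrite trunc_log_gt0.
pose M := ((k * N ^ (2 * k - 1)) %/ p)%N.
have J_le := leq_trans (card_J_le p_pr k_gt0 N_gt0 Np)
  (leq_mul (leqnn _) (leq_mul (leqnn _) (card_pairs_eq_frac_le N k))).
rewrite -/L -/M in J_le.
have D_le : (k * L.+1)%:R <= (2 * k)%:R * L%:R :> R by rewrite -natrM ler_nat; nia.
have M_le : (2 * M).+1%:R <= (2 * k)%:R * Y.
  have : M%:R <= k%:R * (N%:R ^+ (2 * k - 1) / p%:R) :> R.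
    rewrite mulrA ler_pdivlMr // -natrX -!natrM ler_nat; exact: leq_trunc_div.
  have k_ge1 : (1 : R) <= k%:R by rewrite ler1n.
  rewrite -natr1 !natrM /Y; lra.
(* The extra factor [L] comes from the dyadic levels. The base is relaxed through
   [L <= 2 ln N <= 2 k ln N]. *)
have log_le : L%:R ^+ (2 * k * (2 * k).-1).+1 <=
    (2 * k)%:R ^+ (4 * k ^ 2) * ln (N%:R : R) ^+ (4 * k ^ 2).
  apply: (@le_trans _ _ (L%:R ^+ (4 * k ^ 2))).
    by rewrite ler_weXn2l ?ler1n //; nia.
  rewrite -exprMn lerXn2r ?nnegrE ?ler0n ?mulr_ge0 ?ln_ge0 ?ler1n //.
  apply: le_trans (trunc_log_le_ln R N_gt0) _.
  by rewrite ler_wpM2r ?ln_ge0 ?ler1n // ler_nat; lia.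
have ln_gt0 : 0 < ln (N%:R : R) by rewrite ln_gt0 // ltr1n.
have Y_gt0 : 0 < Y by apply: lt_le_trans Y_ge1.
have n_gt1 : (1 < 2 * k)%N by lia.
(* Powers of [2 k]: two from [D] and [2 M + 1], the bracket from the paired tuples with [n = 2 k],
   and [4 k ^ 2] from replacing [L] by [ln N]. The strict inequality of the theorem arises here. *)
have e_lt : (2 + (4 * (2 * k) + 9 * (2 * k) ^ 3) + 4 * k ^ 2 < 90 * k ^ 3)%N by nia.
apply: (@le_lt_trans _ _ ((2 * k)%:R ^+ (2 + (4 * (2 * k) + 9 * (2 * k) ^ 3) + 4 * k ^ 2) *
    ln (N%:R : R) ^+ (4 * k ^ 2) * Y * N%:R ^+ k)); last first.
  rewrite ltr_pM2r ?exprn_gt0 ?ltr0n // ltr_pM2r // ltr_pM2r ?exprn_gt0 //.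
  by rewrite ltr_eXn2l ?ltr1n.
have := J_le; rewrite -(ler_nat R) !natrM => /le_trans; apply.
have E_le := card_paired_tuples_le_log R N_ge2 k_gt0.
rewrite -/L addnn -mul2n in E_le.
rewrite addnn -mul2n -!natrM.
apply: (@le_trans _ _ ((2 * k)%:R * L%:R * ((2 * k)%:R * Y *
  (N%:R ^+ k * (2 * k)%:R ^+ (4 * (2 * k) + 9 * (2 * k) ^ 3) *
    L%:R ^+ (2 * k * (2 * k).-1))))).
  rewrite natrM; apply: ler_pM; rewrite ?ler0n //.
  by rewrite natrM; apply: ler_pM; rewrite ?ler0n.
set e1 := (4 * (2 * k) + _)%N; rewrite (exprD _ (2 + e1)) (exprD _ 2).
move: log_le; rewrite exprS; set a := L%:R ^+ _; set e := _ ^+ e1.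
set c := _ ^+ (4 * _); set d := ln _ ^+ _.
set n := (2 * k)%:R => log_le.
have -> : n * L%:R * (n * Y * (N%:R ^+ k * e * a)) = n ^+ 2 * e * Y * N%:R ^+ k * (L%:R * a).
  by ring.
have -> : n ^+ 2 * e * c * d * Y * N%:R ^+ k = n ^+ 2 * e * Y * N%:R ^+ k * (c * d) by ring.
by rewrite ler_wpM2l // !mulr_ge0 ?exprn_ge0 ?ler0n // ltW.
Qed.
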